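(* Let $(\mathcal{D},\mathcal{Q},\Phi,O,f)$ be a RAG Crawling instance, with $\Phi=(\xi_q)_{q\in\mathcal{Q}}$ a family of mutually independent random elements and each outcome $O_\Phi(q)\subseteq\mathcal{D}$ determined only by $(q,\xi_q)$. Let $B\ge 1$ be an integer query budget. Let $\pi_{\mathrm{greedy}}$ be an adaptive greedy policy issuing $B$ queries, i.e. a policy which at each step $t=1,\dots,B$, given the current retrieval-level partial realization $\psi^R_{t-1}$, selects a query $$q_t\in\arg\max_{q\in\mathcal{Q}}\Delta(q\mid\psi^R_{t-1}).$$ Then $\pi_{\mathrm{greedy}}$ achieves a $(1-1/e)$-approximation to the optimal expected coverage under the same query budget: for every adaptive policy $\pi$ issuing at most $B$ queries, $$\mathbb{E}\left[f(S(\pi_{\mathrm{greedy}},\Phi),\Phi)\right]\ \ge\ \left(1-\frac1e\right)\mathbb{E}\left[f(S(\pi,\Phi),\Phi)\right].$$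
   Context: RAG Crawling instance. $\mathcal{D}$ is a finite set (the hidden corpus, whose elements are documents). $\mathcal{Q}$ is the set of all queries, i.e. valid natural-language strings (hence a countable set). $k$ is a fixed positive integer. $\Phi$ is a random latent realization of the victim retrieval pipeline; conditioned on $\Phi$, issuing a query $q\in\mathcal{Q}$ reveals the outcome set $O_\Phi(q)\subseteq\mathcal{D}$ consisting of the $k$ retrieved items used for $q$. Queries are processed independently with fresh internal randomness: $\Phi=(\xi_q)_{q\in\mathcal{Q}}$ with $\{\xi_q\}_{q\in\mathcal{Q}}$ mutually independent random elements, and $O_\Phi(q)$ is a (measurable) function of $\xi_q$ depending only on $q$. Each query has unit cost, so a budget $B$ means at most $B$ queries are issued. Coverage function. For a finite $S\subseteq\mathcal{Q}$, $f(S,\Phi):=\left|\bigcup_{q\in S}O_\Phi(q)\right|$. Partial realization. A retrieval-level partial realization $\psi$ is a finite set of pairs $(q,o)$ with $q\in\mathcal{Q}$, $o\subseteq\mathcal{D}$, recording the issued queries and their outcome sets, each query appearing at most once. Write $\mathrm{dom}(\psi)\subseteq\mathcal{Q}$ for the set of queries appearing in $\psi$. Conditioning on $\psi$ means conditioning on the event $\{O_\Phi(q)=o\text{ for all }(q,o)\in\psi\}$; only partial realizations for which this event has positive probability are considered. Conditional expected marginal gain (CMG). For $q\in\mathcal{Q}$, $$\Delta(q\mid\psi):=\mathbb{E}\left[f(\mathrm{dom}(\psi)\cup\{q\},\Phi)-f(\mathrm{dom}(\psi),\Phi)\,\middle|\,\psi\right].$$ Adaptive policy. An adaptive policy $\pi$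 is a rule that maps the current partial realization to the next query to issue (or to stop). Starting from $\psi^R_0=\varnothing$, at step $t$ it issues $q_t$ chosen from $\psi^R_{t-1}$, observes $O_\Phi(q_t)$, and sets $\psi^R_t=\psi^R_{t-1}\cup\{(q_t,O_\Phi(q_t))\}$. $S(\pi,\Phi)\subseteq\mathcal{Q}$ denotes the set of queries issued by $\pi$ under realization $\Phi$; the expected coverage of $\pi$ is $\mathbb{E}[f(S(\pi,\Phi),\Phi)]$, and the optimal expected coverage under budget $B$ is the supremum of this quantity over policies issuing at most $B$ queries. *)

(* Defs.v *)
From HB Require Import structures.
From mathcomp Require Import all_boot all_order all_algebra finmap.
From mathcomp Require Import all_classical all_reals all_analysis.

Set Implicit Arguments.
Unset Strict Implicit.
Unset Printing Implicit Defensive.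

Import Order.TTheory GRing.Theory Num.Theory.

Local Open Scope fset_scope.
Local Open Scope fmap_scope.
Local Open Scope classical_set_scope.
Local Open Scope ring_scope.

Definition mutually_independent (R : realType) d (Omega : measurableType d)
    (P : probability Omega R) (Q : choiceType) (dX : Q -> measure_display)
    (X : forall q, measurableType (dX q)) (xi : forall q, Omega -> X q) : Prop :=
  forall (F : {fset Q}) (A : forall q, set (X q)),
    (forall q, q \in F -> measurable (A q)) ->
    P (\bigcap_(q in [set` F]) (xi q @^-1` A q))
    = (\prod_(q <- F) P (xi q @^-1` A q))%E.

(* [{set D}] carries its discrete sigma-algebra, which is why
   [rag_retrieve_measurable] ranges over all sets of outcomes. *)
Record rag_instance (R : realType) (D : finType) (Q : countType) (k : nat) := {
  rag_display : measure_display;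
  rag_space : measurableType rag_display;
  rag_prob : probability rag_space R;
  rag_latent_display : Q -> measure_display;
  rag_latent : forall q, measurableType (rag_latent_display q);
  rag_xi : forall q, rag_space -> rag_latent q;
  rag_retrieve : forall q, rag_latent q -> {set D};
  rag_k_gt0 : (0 < k)%N;
  rag_xi_measurable : forall q, measurable_fun [set: rag_space] (rag_xi q);
  rag_xi_indep : mutually_independent rag_prob rag_xi;
  rag_retrieve_measurable :
    forall q (A : set {set D}), measurable (@rag_retrieve q @^-1` A);
  rag_retrieve_card : forall q (x : rag_latent q), #|rag_retrieve x| = k
}.

(* The finite map encodes that each query occurs at most once;
   its domain [domf psi] is dom(psi). *)
Definition partial_realization (D : finType) (Q : countType) :=
  {fmap Q -> {set D}}.

(* [None] means stop. *)
Definition policy (D : finType) (Q : countType) :=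
  partial_realization D Q -> option Q.

(* The mean of [X] given the event [A]; meaningful when [0 < P A]. *)
Definition cond_expectation (R : realType) d (Omega : measurableType d)
    (P : probability Omega R) (A : set Omega) (X : Omega -> R) : R :=
  (\int[P]_(w in A) X w) / fine (P A).

Section Crawling.
Variables (R : realType) (D : finType) (Q : countType) (k : nat).
Variable I : rag_instance R D Q k.
Local Notation Omega := (rag_space I).
Local Notation P := (rag_prob I).
Implicit Types (w : Omega) (psi : partial_realization D Q) (pi : policy D Q).

Definition outcome (q : Q) w : {set D} := rag_retrieve (rag_xi q w).

Definition coverage (S : {fset Q}) w : nat :=
  #|(\bigcup_(q <- S) outcome q w)%SET|.

Definition consistent psi : set Omega :=
  [set w | forall q, q \in domf psi -> psi.[? q] = Some (outcome q w)].

Definition marginal_gain (q : Q) psi : R :=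
  cond_expectation P (consistent psi)
    (fun w => (coverage (q |` domf psi)%fset w)%:R - (coverage (domf psi) w)%:R).

(* The partial realization after [t] steps. Re-issuing a query uses up a step
   and leaves the partial realization unchanged. *)
Fixpoint run pi w (t : nat) : partial_realization D Q :=
  if t is t'.+1 then
    let psi := run pi w t' in
    if pi psi is Some q then psi.[q <- outcome q w] else psi
  else [fmap].

(* A budget [B] cuts the execution of the rule off after [B] steps, so [pi]
   ranging over all rules amounts to ranging over the policies issuing at most
   [B] queries, and a rule that has stopped by then has its whole set of issued
   queries counted (lemmas [card_issued] and [issued_stop]). *)
Definition issued (B : nat) pi w : {fset Q} := domf (run pi w B).

Definition expected_coverage (B : nat) pi : \bar R :=
  ('E_P[fun w => (coverage (issued B pi w) w)%:R])%E.

Definition greedy_policy (B : nat) pi : Prop :=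
  forall w (t : nat), (t < B)%N ->
    let psi := run pi w t in
    (0 < P (consistent psi))%E ->
    exists2 q, pi psi = Some q &
      forall q', marginal_gain q' psi <= marginal_gain q psi.

Lemma card_issued (B : nat) pi w : (#|` issued B pi w| <= B)%N.
Proof.
rewrite /issued; elim: B => [|B IHB] /=; first by [].
case: (pi _) => [q|]; last exact: leqW.
by rewrite dom_setf cardfsU1; case: (_ \notin _) => //; apply: leqW.
Qed.

Lemma issued_stop (B n : nat) pi w :
  pi (run pi w B) = None -> (B <= n)%N -> issued n pi w = issued B pi w.
Proof.
move=> stopB /subnK <-; rewrite /issued.
suff -> : run pi w (n - B + B) = run pi w B by [].
by elim: (n - B)%N => //= m ->; rewrite stopB.
Qed.

End Crawling.

(* Main.v *)
(** By independence, an execution is a random walk on partial realizations in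
    which a new query [q] has outcome [o] with probability [outcome_pmf q o],
    whatever is already known.  Let [A phi] be the expected coverage of [phi]
    together with a run of the competitor [pi] from scratch, where the answers
    recorded in [phi] are reused.  On average over the answer to one more query,
    [A] does not decrease, and [A phi <= |covered phi| + B * g] when [g] is the
    largest marginal gain at [phi], since marginal gains only shrink as more is
    known.  So a greedy step closes, on average, at least the fraction [1 / B]
    of the gap [A phi - |covered phi|], and [(1 - 1 / B) ^ B <= 1 / e]. *)
Require Import Defs.
From HB Require Import structures.
From mathcomp Require Import all_boot all_order all_algebra finmap.
From mathcomp Require Import all_classical all_reals all_analysis.
From mathcomp Require Import measurable_realfun ring lra.

Set Implicit Arguments.
Unset Strict Implicit.
Unset Printing Implicit Defensive.

Import Order.TTheory GRing.Theory Num.Theory.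

Local Open Scope ring_scope.

Lemma mem_domf_setf (K : choiceType) (V : Type) (f : {fmap K -> V}) (x y : K) (v : V) :
  (y \in domf f.[x <- v]%fmap) = (y == x) || (y \in domf f).
Proof. by rewrite dom_setf in_fset1U. Qed.

Lemma big_domf_setf (T : Type) (idx : T) (op : Monoid.com_law idx) (K : choiceType)
    (V : Type) (f : {fmap K -> V}) (x : K) (v : V) (F : K -> T) : x \notin domf f ->
  \big[op/idx]_(y <- domf f.[x <- v]%fmap) F y
  = op (F x) (\big[op/idx]_(y <- domf f) F y).
Proof. by move=> xf; rewrite dom_setf big_fsetU1. Qed.

(** * Coverage of a policy as a finite recursion over the answer laws [mu] *)

Section FinitaryCrawling.
Context {R : realType} {D : finType} {Q : countType}.
Variable mu : Q -> {set D} -> R.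
Hypothesis mu_ge0 : forall q o, 0 <= mu q o.
Hypothesis mu_sum1 : forall q, \sum_o mu q o = 1.
Implicit Types (pi : policy D Q) (psi phi : partial_realization D Q).

Definition covered phi : {set D} :=
  (\bigcup_(q <- domf phi) odflt finset.set0 phi.[? q]%fmap)%SET.

(** For [q] outside [phi] this is the marginal gain; for a recorded query it is the gain of a fresh
    independent answer, hence the side conditions [q \notin domf phi] below. *)
Definition gain q phi : R := \sum_o mu q o * #|o :\: covered phi|%:R.

(* Expected coverage of [phi] extended by [n] steps of [pi] started from memory
   [psi]; a query already in [phi] is answered by [phi], so the memory of [pi]
   may lag behind the knowledge [phi]. *)
Fixpoint value pi n psi phi : R :=
  if n is n'.+1 then
    if pi psi is Some q then
      if phi.[? q]%fmap is Some o then value pi n' psi.[q <- o]%fmap phi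
      else \sum_o mu q o * value pi n' psi.[q <- o]%fmap phi.[q <- o]%fmap
    else value pi n' psi phi
  else #|covered phi|%:R.

Lemma value_stop pi n psi phi : pi psi = None ->
  value pi n.+1 psi phi = value pi n psi phi.
Proof. by move=> /= ->. Qed.

Lemma value_known pi n psi phi q o : pi psi = Some q -> phi.[? q]%fmap = Some o ->
  value pi n.+1 psi phi = value pi n psi.[q <- o]%fmap phi.
Proof. by move=> /= -> ->. Qed.

Lemma value_fresh pi n psi phi q : pi psi = Some q -> q \notin domf phi ->
  value pi n.+1 psi phi
  = \sum_o mu q o * value pi n psi.[q <- o]%fmap phi.[q <- o]%fmap.
Proof. by move=> /= -> qphi; rewrite not_fnd. Qed.

Lemma covered_fmap0 : covered [fmap]%fmap = finset.set0.
Proof. by rewrite /covered big_seq_fset0. Qed.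

Lemma covered_setf q o phi : q \notin domf phi ->
  covered phi.[q <- o]%fmap = (o :|: covered phi)%SET.
Proof.
move=> qphi; rewrite /covered big_domf_setf //= fnd_set eqxx /=; congr (_ :|: _)%SET.
apply: eq_big_seq => r rphi.
by rewrite fnd_set; case: eqP => // rq; rewrite rq (negbTE qphi) in rphi.
Qed.

Lemma card_covered_setf q o phi : q \notin domf phi ->
  #|covered phi.[q <- o]%fmap|%:R
  = #|covered phi|%:R + #|o :\: covered phi|%:R :> R.
Proof.
move=> qphi; rewrite covered_setf // finset.setUC -natrD; congr (_%:R).
by rewrite cardsU cardsD finset.setIC addnBA // subset_leq_card // finset.subsetIl.
Qed.

Lemma sum_mu_cst q (a : R) : \sum_o mu q o * a = a.
Proof. by rewrite -mulr_suml mu_sum1 mul1r. Qed.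

Lemma le_sum_mu q (F G : {set D} -> R) : (forall o, F o <= G o) ->
  \sum_o mu q o * F o <= \sum_o mu q o * G o.
Proof. by move=> FG; apply: ler_sum => o _; apply: ler_wpM2l. Qed.

Lemma mean_covered_setf q phi : q \notin domf phi ->
  \sum_o mu q o * #|covered phi.[q <- o]%fmap|%:R = #|covered phi|%:R + gain q phi.
Proof.
move=> qphi.
under eq_bigr => o _ do rewrite card_covered_setf // mulrDr.
by rewrite big_split /= sum_mu_cst.
Qed.

Lemma gain_ge0 q phi : 0 <= gain q phi.
Proof. by apply: sumr_ge0 => o _; apply: mulr_ge0. Qed.

Lemma value_ge0 pi n psi phi : 0 <= value pi n psi phi.
Proof.
elim: n psi phi => //= n IH psi phi.
case: (pi psi) => // q; case: (phi.[? q]%fmap) => [//|].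
by apply: sumr_ge0 => o _; apply: mulr_ge0.
Qed.

(** The law [mu r] does not depend on what is known, so only the growth of the covered set
    matters. *)
Lemma gain_setf r q o phi : q \notin domf phi -> gain r phi.[q <- o]%fmap <= gain r phi.
Proof.
move=> qphi; apply: le_sum_mu => o'.
by rewrite covered_setf // ler_nat subset_leq_card // finset.setDS // finset.subsetUr.
Qed.

(* Revealing one more outcome in advance does not hurt: the coverage counts it,
   and [pi] behaves as if it had not been revealed. *)
Lemma value_reveal pi n psi phi q : q \notin domf phi ->
  value pi n psi phi <= \sum_o mu q o * value pi n psi phi.[q <- o]%fmap.
Proof.
elim: n psi phi => [|n IH] psi phi qphi.
  by rewrite mean_covered_setf // lerDl gain_ge0.
have fresh r o : r != q -> r \notin domf phi -> r \notin domf phi.[q <- o]%fmap.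
  by rewrite mem_domf_setf negb_or => ->.
case pipsi: (pi psi) => [r|]; last first.
  by under eq_bigr => o _ do rewrite value_stop //; rewrite value_stop // IH.
have [rq|rq] := eqVneq r q.
  (* Here [pi] asks the revealed query itself: both sides average over the same answer, drawn now on
     the left and beforehand on the right. *)
  rewrite rq in pipsi; rewrite (value_fresh _ pipsi qphi).
  apply: ler_sum => o _.
  by rewrite (value_known (o := o) _ pipsi) // fnd_set eqxx.
case rphi: (phi.[? r]%fmap) => [ o|].
  rewrite (value_known _ pipsi rphi).
  under eq_bigr => o' _.
    rewrite (value_known (o := o) _ pipsi).
    over.
    by rewrite fnd_set (negbTE rq).
  exact: IH.
have {}rphi : r \notin domf phi by case: fndP rphi.
rewrite (value_fresh _ pipsi rphi).
under [leRHS]eq_bigr => o _.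
  rewrite (value_fresh _ pipsi (fresh _ _ rq rphi)) mulr_sumr.
  over.
(* The answers to [r] and [q] can be drawn in either order; with [r] first, the induction hypothesis
   applies to each extension of [phi] by [r]. *)
rewrite exchange_big /=; apply: ler_sum => o _.
under eq_bigr => o' _ do rewrite mulrCA setfC (negbTE rq).
rewrite -mulr_sumr ler_wpM2l // IH // mem_domf_setf negb_or qphi andbT.
by rewrite eq_sym.
Qed.

(* Adaptive submodularity: no later step gains more than [g] on average. *)
Lemma value_le pi n psi phi (g : R) :
    0 <= g -> (forall q, q \notin domf phi -> gain q phi <= g) ->
  value pi n psi phi <= #|covered phi|%:R + n%:R * g.
Proof.
move=> g0; elim: n psi phi => [|n IH] psi phi gP.
  by rewrite mul0r addr0.
have step psi' : value pi n psi' phi <= #|covered phi|%:R + n.+1%:R * g.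
  by apply: le_trans (IH _ _ gP) _; rewrite lerD2l ler_wpM2r // ler_nat.
case pipsi: (pi psi) => [q|]; last by rewrite value_stop.
case qphi: (phi.[? q]%fmap) => [ o|].
  by rewrite (value_known _ pipsi qphi).
have {}qphi : q \notin domf phi by case: fndP qphi.
rewrite (value_fresh _ pipsi qphi).
(* The same bound [g] serves after every answer, because gains only shrink. *)
apply: (@le_trans _ _
    (\sum_o mu q o * (#|covered phi.[q <- o]%fmap|%:R + n%:R * g))).
  apply: le_sum_mu => o; apply: IH => r.
  rewrite mem_domf_setf negb_or => /andP[_ rphi].
  exact: le_trans (gain_setf _ _ qphi) (gP _ rphi).
under eq_bigr => o _ do rewrite mulrDr.
rewrite big_split /= sum_mu_cst mean_covered_setf // -natr1.
by have := gP _ qphi; lra.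
Qed.

End FinitaryCrawling.

(** * Independence and the laws of the outcomes *)

Section CrawlingProcess.
Local Open Scope classical_set_scope.
Local Open Scope ring_scope.
Context {R : realType} {D : finType} {Q : countType} {k : nat}.
Variable I : rag_instance R D Q k.
Local Notation P := (rag_prob I).
Implicit Types (pi : policy D Q) (psi phi : partial_realization D Q).

Local Notation outcome := (@outcome R D Q k I).
Local Notation consistent := (@consistent R D Q k I).

Definition outcome_pmf q (o : {set D}) : R := fine (P (outcome q @^-1` [set o])).

Lemma measurable_outcome q (A : set {set D}) : measurable (outcome q @^-1` A).
Proof.
have := rag_xi_measurable measurableT (rag_retrieve_measurable I q A).
by rewrite setTI.
Qed.

Lemma consistent_bigcap phi : consistent phi =
  \bigcap_(q in [set` domf phi]) (outcome q @^-1` [set o | phi.[? q]%fmap = Some o]).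
Proof. by []. Qed.

Lemma measurable_consistent phi : measurable (consistent phi).
Proof.
rewrite consistent_bigcap; apply: fin_bigcap_measurable => // q _.
exact: measurable_outcome.
Qed.

Lemma consistent_setf q o phi : q \notin domf phi ->
  consistent phi.[q <- o]%fmap = consistent phi `&` outcome q @^-1` [set o].
Proof.
move=> qphi; apply/seteqP; split => w /=.
  move=> cw; split => [r rphi|].
    have := cw r; rewrite mem_domf_setf rphi orbT => /(_ isT).
    by rewrite fnd_set; case: eqP => // rq; rewrite rq (negbTE qphi) in rphi.
  by have := cw q; rewrite mem_domf_setf fnd_set eqxx => /(_ isT) [].
move=> [cw wo] r; rewrite mem_domf_setf fnd_set.
by case: (eqVneq r q) => [->|_ /= /cw //] _; rewrite wo.
Qed.

Lemma prob_consistent_prod phi : P (consistent phi) =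
  (\prod_(q <- domf phi) P (outcome q @^-1` [set o | phi.[? q]%fmap = Some o]))%E.
Proof.
rewrite consistent_bigcap.
apply: (rag_xi_indep (r := I) (F := domf phi) (A := fun q : Q =>
  @rag_retrieve _ _ _ _ I q @^-1` [set o | phi.[? q]%fmap = Some o])).
by move=> q _; apply: rag_retrieve_measurable.
Qed.

Lemma outcome_pmfE q o : (outcome_pmf q o)%:E = P (outcome q @^-1` [set o]).
Proof. by rewrite fineK //; apply: fin_num_measure; apply: measurable_outcome. Qed.

Lemma outcome_pmf_ge0 q o : 0 <= outcome_pmf q o.
Proof. exact: fine_ge0. Qed.

(** Independence in the form used below: given [phi], a new query still has the unconditional law
    [outcome_pmf q]. *)
Lemma prob_consistent_setf q o phi : q \notin domf phi ->
  P (consistent phi.[q <- o]%fmap) = (P (consistent phi) * (outcome_pmf q o)%:E)%E.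
Proof.
move=> qphi; rewrite !prob_consistent_prod big_domf_setf //= muleC; congr (_ * _)%E.
  apply: eq_big_seq => r rphi; rewrite fnd_set.
  by case: eqP => // rq; rewrite rq (negbTE qphi) in rphi.
rewrite outcome_pmfE; congr (P (_ @^-1` _)).
by apply/seteqP; split => o' /=; rewrite fnd_set eqxx; [case|move=> ->].
Qed.

Lemma trivIset_outcome q (A : set (rag_space I)) (J : set {set D}) :
  trivIset J (fun o => A `&` outcome q @^-1` [set o]).
Proof. by move=> o o' _ _ [w [[_ <-] [_ <-]]]. Qed.

Lemma bigcup_outcome q (A : set (rag_space I)) :
  A = \big[setU/set0]_(o <- enum {set D}) (A `&` outcome q @^-1` [set o]).
Proof.
rewrite -bigcup_seq; apply/seteqP; split => [w Aw|w [ o' _ []]] //.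
by exists (outcome q w) => //=; rewrite mem_enum.
Qed.

(** The answer to [q] cuts [A] into finitely many measurable pieces. Measurability on [A] is a
    conclusion, since the coverage of a run is first understood piece by piece. *)
Lemma integral_outcome q (A : set (rag_space I)) (f : rag_space I -> \bar R) :
    measurable A -> (forall w, (0 <= f w)%E) ->
    (forall o, measurable_fun (A `&` outcome q @^-1` [set o]) f) ->
  measurable_fun A f /\
  (\int[P]_(w in A) f w
   = \sum_o \int[P]_(w in A `&` outcome q @^-1` [set o]) f w)%E.
Proof.
move=> mA f0 mf.
have mAo o : measurable (A `&` outcome q @^-1` [set o]).
  by apply: measurableI => //; apply: measurable_outcome.
have [_ mfA] : measurable A /\ measurable_fun A f.
  rewrite (bigcup_outcome q A).
  (* Measurability of the sets is carried along because gluing two pieces requires it. *)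
  apply: (big_ind (fun S => measurable S /\ measurable_fun S f)) => //.
    by split => //; apply: measurable_fun_set0.
  move=> S T [mS fS] [mT fT]; split; first exact: measurableU.
  by apply/measurable_funU.
split => //.
rewrite {1}(bigcup_outcome q A) ge0_integral_bigsetU //.
- by rewrite big_enum.
- exact: enum_uniq.
- exact: trivIset_outcome.
- by rewrite -bigcup_outcome.
Qed.

Lemma outcome_pmf_sum1 q : \sum_o outcome_pmf q o = 1.
Proof.
apply: EFin_inj; rewrite -sumEFin -(probability_setT P).
have [_] := @integral_outcome q setT (cst 1%E) measurableT (fun=> lee01)
  (fun=> measurable_cst _).
rewrite integral_cst // mul1e => ->; apply: eq_bigr => o _.
by rewrite setTI integral_cst ?mul1e ?outcome_pmfE //; apply: measurable_outcome.
Qed.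

(** * Runs of a policy and marginal gains in terms of the recursion *)

Local Notation covered := (@covered D Q).
Local Notation gain := (gain outcome_pmf).
Local Notation value := (value outcome_pmf).

Lemma coverage_consistent phi w : consistent phi w ->
  (\bigcup_(q <- domf phi) outcome q w)%SET = covered phi.
Proof. by move=> cw; apply: eq_big_seq => q /cw ->. Qed.

(** Iterating a single step allows a start from any [psi], and lets the first step be peeled off as
    [value] does, whereas [run] peels off the last. *)
Definition advance pi (w : rag_space I) psi : partial_realization D Q :=
  if pi psi is Some q then psi.[q <- outcome q w]%fmap else psi.

Lemma runE pi w n : run pi w n = iter n (advance pi w) [fmap]%fmap.
Proof. by elim: n => //= n ->. Qed.

Lemma setf_consistent psi w q : consistent psi w -> q \in domf psi ->
  psi.[q <- outcome q w]%fmap = psi.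
Proof.
move=> cw qpsi; apply/fmapP => r; rewrite fnd_set.
by case: eqP => // ->; rewrite (cw _ qpsi).
Qed.

Lemma consistent_advance pi psi w : consistent psi w -> consistent (advance pi w psi) w.
Proof.
rewrite /advance; case: (pi psi) => // q cw.
have [qpsi|qpsi] := boolP (q \in domf psi); first by rewrite setf_consistent.
by rewrite consistent_setf.
Qed.

Lemma consistent_iter pi psi w n : consistent psi w ->
  consistent (iter n (advance pi w) psi) w.
Proof. by move=> cw; elim: n => //= n; apply: consistent_advance. Qed.

(** Conditioning on the answer to the next query reproduces the recursion of [value]. The factor
    [P (consistent psi)] replaces a division, so null events need no separate treatment. *)
Lemma integral_covered_iter pi n psi :
  let f w := (#|covered (iter n (advance pi w) psi)|%:R : R)%:E in
  measurable_fun (consistent psi) f /\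
  (\int[P]_(w in consistent psi) f w
   = P (consistent psi) * (value pi n psi psi)%:E)%E.
Proof.
elim: n psi => [|n IH] psi.
  split => /=; first exact: measurable_cst.
  by rewrite muleC -(integral_cst P (measurable_consistent psi)).
have [mf intf] := IH psi.
have mem_in w : w \in consistent psi -> consistent psi w by rewrite inE.
move=> f; case pipsi: (pi psi) => [q|]; last first.
  have fE w : iter n.+1 (advance pi w) psi = iter n (advance pi w) psi.
    by rewrite iterSr /advance pipsi.
  rewrite value_stop //; split; last first.
    by rewrite -intf; apply: eq_integral => w _; rewrite /f fE.
  by apply: eq_measurable_fun mf => w _; rewrite /f fE.
case qpsi: (psi.[? q]%fmap) => [ o|].
  have qdom : q \in domf psi by case: fndP qpsi.
  rewrite (value_known _ _ pipsi qpsi).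
  have -> : psi.[q <- o]%fmap = psi.
    by apply/fmapP => r; rewrite fnd_set; case: eqP => // ->.
  have fE w : consistent psi w ->
      iter n.+1 (advance pi w) psi = iter n (advance pi w) psi.
    by move=> cw; rewrite iterSr {2}/advance pipsi setf_consistent.
  split.
    by apply: eq_measurable_fun mf => w /mem_in cw; rewrite /f fE.
  by rewrite -intf; apply: eq_integral => w /mem_in cw; rewrite /f fE.
(* For a new query, split by its answer; on each piece the first step is deterministic. *)
have {}qpsi : q \notin domf psi by case: fndP qpsi.
have fE o w : w \in consistent psi.[q <- o]%fmap ->
    iter n.+1 (advance pi w) psi = iter n (advance pi w) psi.[q <- o]%fmap.
  rewrite consistent_setf // inE => -[_ <-].
  by rewrite iterSr {2}/advance pipsi.
have [] := @integral_outcome q (consistent psi)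
    (fun w => (#|covered (iter n.+1 (advance pi w) psi)|%:R : R)%:E).
- exact: measurable_consistent.
- by move=> w; rewrite lee_fin.
- move=> o; rewrite -consistent_setf //.
  by apply: eq_measurable_fun (IH _).1 => w /fE ->.
move=> mf' intf'; split => //.
rewrite intf' (value_fresh _ _ pipsi qpsi) -sumEFin ge0_sume_distrr; last first.
  move=> o _; rewrite lee_fin mulr_ge0 ?outcome_pmf_ge0 //.
  by apply: value_ge0; apply: outcome_pmf_ge0.
apply: eq_bigr => o _.
rewrite -consistent_setf // EFinM muleA -prob_consistent_setf // -(IH _).2.
by apply: eq_integral => w /fE ->.
Qed.

Lemma consistent_fmap0 : consistent [fmap]%fmap = setT.
Proof. by apply/seteqP; split => // w _ q; rewrite in_fset0. Qed.

Lemma expected_coverageE n pi :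
  expected_coverage I n pi = (value pi n [fmap]%fmap [fmap]%fmap)%:E.
Proof.
rewrite /expected_coverage unlock.
have [_] := integral_covered_iter pi n [fmap]%fmap.
rewrite consistent_fmap0 probability_setT mul1e => <-.
apply: eq_integral => w _.
have cw : consistent (run pi w n) w.
  by rewrite runE; apply: consistent_iter; rewrite consistent_fmap0.
by rewrite /coverage (coverage_consistent cw) runE.
Qed.

Lemma marginal_gain_known q phi : q \in domf phi -> marginal_gain I q phi = 0.
Proof.
move=> qphi; rewrite /marginal_gain /cond_expectation.
have -> : (q |` domf phi)%fset = domf phi by apply/fsetUidPr; rewrite fsub1set.
under eq_Rintegral do rewrite subrr.
by rewrite /Rintegral integral0 fine0 mul0r.
Qed.

(** On the conditioning event the old coverage is the fixed set [covered phi], so only the answer to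
    [q] is random and its law factors out. *)
Lemma marginal_gainE q phi : q \notin domf phi -> (0 < P (consistent phi))%E ->
  marginal_gain I q phi = gain q phi.
Proof.
move=> qphi Pphi.
rewrite /marginal_gain /cond_expectation.
pose f w : R := #|outcome q w :\: covered phi|%:R.
have -> : \int[P]_(w in consistent phi)
    ((coverage (q |` domf phi)%fset w)%:R - (coverage (domf phi) w)%:R)
    = \int[P]_(w in consistent phi) f w.
  apply: eq_Rintegral => w; rewrite inE => cw.
  rewrite /coverage coverage_consistent // big_fsetU1 //= coverage_consistent //.
  rewrite finset.setUC cardsU finset.setIC -addnBA ?subset_leq_card ?finset.subsetIl //.
  by rewrite -cardsD natrD addrC addKr.
have mc := measurable_consistent phi.
have fE o w : w \in consistent phi `&` outcome q @^-1` [set o] ->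
    (f w)%:E = (#|o :\: covered phi|%:R)%:E.
  by rewrite inE => -[_ <-].
have [] := @integral_outcome q (consistent phi) (EFin \o f).
- exact: mc.
- by move=> w; rewrite lee_fin.
- move=> o; apply: eq_measurable_fun (measurable_cst (#|o :\: covered phi|%:R%:E)).
  by move=> w /fE /= ->.
move=> _ intf; rewrite /Rintegral intf.
have -> : (\sum_o \int[P]_(w in consistent phi `&` outcome q @^-1` [set o])
        (EFin \o f) w
    = P (consistent phi) * (gain q phi)%:E)%E.
  rewrite -sumEFin ge0_sume_distrr; last first.
    by move=> o _; rewrite lee_fin mulr_ge0 ?outcome_pmf_ge0.
  apply: eq_bigr => o _.
  rewrite EFinM muleA -prob_consistent_setf // consistent_setf // muleC.
  rewrite -integral_cst; first by apply: eq_integral => w /fE.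
  by apply: measurableI => //; apply: measurable_outcome.
have fin : P (consistent phi) \is a fin_num by exact: fin_num_measure.
rewrite fineM // mulrAC divff ?mul1r //.
by rewrite gt_eqF // fine_gt0 // Pphi ltey_eq fin.
Qed.

End CrawlingProcess.

(** * The greedy recursion and the approximation factor *)

Section Greedy.
Context {R : realType} {D : finType} {Q : countType} {k : nat}.
Variables (I : rag_instance R D Q k) (B : nat) (pi_greedy pi : policy D Q).
Hypothesis B_gt0 : (0 < B)%N.
Hypothesis greedyP : greedy_policy I B pi_greedy.
Local Notation value := (value (outcome_pmf I)).
Local Notation benchmark phi := (value pi B [fmap]%fmap phi).

Let c : R := 1 - B%:R^-1.

Lemma decay_ge0 : 0 <= c.
Proof. by rewrite subr_ge0 invf_le1 ?ltr0n // ler1n. Qed.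

Lemma decay_le1 : c <= 1.
Proof. by rewrite gerBl invr_ge0. Qed.

(** Induction on the number [n] of remaining steps: each leaves on average at most the fraction [c]
    of the gap between benchmark and coverage. The assumption on [run] places [phi] on actual
    executions, the only states where greediness is assumed. *)
Lemma greedy_value_ge n phi : (n <= B)%N -> (0 < rag_prob I (consistent phi))%E ->
    (forall w, consistent (I := I) phi w -> run pi_greedy w (B - n) = phi) ->
  (1 - c ^+ n) * benchmark phi + c ^+ n * #|covered phi|%:R
    <= value pi_greedy n phi phi.
Proof.
elim: n phi => [|n IH] phi nB Pphi runphi.
  by rewrite expr0 subrr mul0r add0r mul1r.
(* A sample point is needed to invoke [greedyP], which speaks of runs; positive probability provides
   one. *)
have [w cw] : exists w, consistent (I := I) phi w.
  apply/set0P; apply: contraTneq Pphi => ->.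
  by rewrite measure0 ltxx.
have ltB : (B - n.+1 < B)%N by rewrite ltn_subrL.
have := @greedyP w _ ltB; rewrite runphi // => /(_ Pphi) [q piq qmax].
have BnS : (B - n = (B - n.+1).+1)%N by rewrite subnSK.
set g := marginal_gain I q phi in qmax.
have gE : q \notin domf phi -> g = gain (outcome_pmf I) q phi.
  by move=> qphi; rewrite /g marginal_gainE.
have g_ge0 : 0 <= g.
  have [qphi|qphi] := boolP (q \in domf phi).
    by rewrite /g marginal_gain_known.
  by rewrite gE //; apply: gain_ge0; apply: outcome_pmf_ge0.
have gmax r : r \notin domf phi -> gain (outcome_pmf I) r phi <= g.
  by move=> rphi; rewrite -marginal_gainE.
have bench_le : benchmark phi <= #|covered phi|%:R + B%:R * g.
  by apply: value_le => //; [exact: outcome_pmf_ge0 | exact: outcome_pmf_sum1].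
have cn_ge0 : 0 <= c ^+ n by rewrite exprn_ge0 // decay_ge0.
have cn_le1 : 0 <= 1 - c ^+ n.
  by rewrite subr_ge0 exprn_ile1 // ?decay_ge0 ?decay_le1.
(* The right side exceeds the left by [c ^+ n] times the difference between [g] and the fraction
   [1 / B] of the gap, nonnegative by [bench_le]. *)
have step : (1 - c ^+ n.+1) * benchmark phi + c ^+ n.+1 * #|covered phi|%:R
    <= (1 - c ^+ n) * benchmark phi + c ^+ n * (#|covered phi|%:R + g).
  rewrite -subr_ge0 exprS.
  rewrite [leRHS](_ : _ = c ^+ n * (g - B%:R^-1 * (benchmark phi - #|covered phi|%:R))).
    by rewrite mulr_ge0 // subr_ge0 mulrC ler_pdivrMr ?ltr0n // mulrC lerBlDl.
  by rewrite /c; ring.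
apply: le_trans step _.
(* A greedy policy may repeat a query, but only when the largest gain [g] is zero; the state then
   stays put. *)
have [qphi|qphi] := boolP (q \in domf phi).
  rewrite (value_known _ _ piq (in_fnd qphi)).
  have -> : phi.[q <- phi.[qphi]]%fmap = phi.
    by apply/fmapP => r; rewrite fnd_set; case: eqP => // ->; rewrite in_fnd.
  have -> : g = 0 by rewrite /g marginal_gain_known.
  rewrite addr0; apply: IH => [|//|v cv]; first exact: ltnW.
  by rewrite BnS /= runphi // piq setf_consistent.
rewrite (value_fresh _ _ piq qphi).
have -> : #|covered phi|%:R + g
    = \sum_o outcome_pmf I q o * #|covered phi.[q <- o]%fmap|%:R.
  by rewrite gE // mean_covered_setf // => r; apply: outcome_pmf_sum1.
(* By [value_reveal], the benchmark does not decrease on average when the answer to [q] is added. *)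
apply: (@le_trans _ _ (\sum_o outcome_pmf I q o *
    ((1 - c ^+ n) * benchmark phi.[q <- o]%fmap
     + c ^+ n * #|covered phi.[q <- o]%fmap|%:R))).
  under [leRHS]eq_bigr => o _ do rewrite mulrDr 2!(mulrCA (outcome_pmf I q o)).
  rewrite big_split /= -!mulr_sumr lerD2r ler_wpM2l // value_reveal //.
    exact: outcome_pmf_ge0.
  exact: outcome_pmf_sum1.
apply: ler_sum => o _.
(* Answers of probability zero contribute nothing; the others keep the event positive, as the
   induction hypothesis requires. *)
have := outcome_pmf_ge0 I q o; rewrite le_eqVlt => /predU1P[<-|mu_gt0].
  by rewrite !mul0r.
rewrite ler_pM2l //; apply: IH => [||v].
- exact: ltnW.
- by rewrite prob_consistent_setf // mule_gt0.
- rewrite consistent_setf // => -[cv /= <-].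
  by rewrite BnS /= runphi // piq.
Qed.

End Greedy.

Theorem theorem3 (R : realType) (D : finType) (Q : countType) (k : nat)
    (I : rag_instance R D Q k) (B : nat) (hB : (1 <= B)%N)
    (pi_greedy : policy D Q) (hgreedy : greedy_policy I B pi_greedy)
    (pi : policy D Q) :
  (expected_coverage I B pi_greedy
     >= (1 - 1 / expR 1)%:E * expected_coverage I B pi)%E.
Proof.
rewrite !expected_coverageE -EFinM lee_fin.
apply: le_trans (greedy_value_ge pi hB hgreedy (leqnn B) _ _); first last.
- by move=> w _; rewrite subnn.
- by rewrite consistent_fmap0 probability_setT.
rewrite covered_fmap0 cards0 mulr0 addr0 ler_wpM2r //.
  by apply: value_ge0; apply: outcome_pmf_ge0.
rewrite lerD2l lerN2 div1r -expRN.
(* Writing the exponent this way reduces [c ^+ B <= expR (- 1)] to the [B]-th power of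
   [1 + x <= expR x] at [x = - B%:R^-1]. *)
have -> : - 1 = B%:R * - B%:R^-1 :> R.
  by rewrite mulrN divff // pnatr_eq0 -lt0n.
rewrite expRM_natl lerXn2r ?nnegrE ?expR_ge0 ?decay_ge0 //.
exact: expR_ge1Dx.
Qed.
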